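(* Let $\alpha>-1$, $\beta\in\mathbb{R}$, $k^2\in(0,1)$, and let $\beta_n$ be the recurrence coefficients of the monic polynomials orthogonal with respect to $w(x,k^2)=(1-x^2)^{\alpha}(1-k^2x^2)^{\beta}$ on $[-1,1]$. Then for every $n\ge1$, $\beta_n$ satisfies the second-order difference equation, algebraic of total degree $6$ in $\beta_{n+1},\beta_n,\beta_{n-1}$, $$\sum_{p=0}^{3}\sum_{q=0}^{6}\sum_{r=0}^{3}c_{p,q,r}\,\beta_{n+1}^{p}\,\beta_n^{q}\,\beta_{n-1}^{r}=0,\qquad p+q+r\le 6,$$ where the coefficients $c_{p,q,r}$ (depending on $n,\alpha,\beta,k^2$) are the $34$ explicit expressions listed in the context, all other $c_{p,q,r}$ being zero.
   Context: For $\alpha>-1$, $\beta\in\mathbb{R}$, $k^2\in(0,1)$, the weight is $w(x,k^2)=(1-x^2)^{\alpha}(1-k^2x^2)^{\beta}$, $x\in[-1,1]$. For $n\ge0$, $P_n$ is the monic polynomial of degree $n$ with $\int_{-1}^1 P_i(x)P_j(x)w(x,k^2)\,dx=h_j\delta_{i,j}$. The recurrence coefficients $\beta_n$ (with an index; $\beta$ without index is the exponent) are defined by $xP_n(x)=P_{n+1}(x)+\beta_nP_{n-1}(x)$, with $P_{-1}:=0$, $\beta_0:=0$; thus $\beta_n=h_n/h_{n-1}$ for $n\ge1$. Write $N:=\alpha+\beta+n$. The coefficients are: $c_{0,0,0}=(k^2-1)^2n(n+2\alpha)(n+2\beta)(n+2\alpha+2\beta)$. $c_{0,1,0}=\alpha^2(-3-4\beta^2+4\alpha^2)(k^2+1)(k^2-1)^2(2N-3)(2N+3)N^2-\frac29(4\alpha^2-1)(\alpha^2-\beta^2)(k^2+1)(k^2-1)^2(2N-3)(2N+3)(2N-1)(2N+1)-\frac19(4\alpha^4-4\alpha^2\beta^2-19\alpha^2-8\beta^2+18)(k^2+1)(k^2-1)^2(2N-1)(2N+1)N^2+2(k^2+1)N^2-(\alpha^2-\beta^2)(16n\alpha+16\alpha\beta+1+16n\beta+8n^2)(k^2-1)^2+(4\alpha\beta+2n^2-\beta^2+5\alpha^2+4n\alpha+4n\beta)(k^2-1)(k^2+1)$.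 $c_{0,1,1}=8k^2(N-\frac32)\big[(k^2-1)^2N^3+\frac12(k^4+1)N^2-(\alpha^2+\beta^2)(k^2-1)^2N+\frac12(k^4-1)(\alpha^2-\beta^2)\big]$. $c_{1,1,0}=8k^2(N+\frac32)\big[(k^2-1)^2N^3-\frac12(k^4+1)N^2-(k^2-1)^2(\alpha^2+\beta^2)N-\frac12(k^4-1)(\alpha^2-\beta^2)\big]$. $c_{0,2,0}=-8(k^4+1)(k^2-1)^2N^4+24(k^2+1)^2(k^2-1)^2N^4-7(k^4+1)(k^2+1)^2N^2+(k^4+1)(k^2-1)^2N^2(8\alpha^2+8\beta^2+3)+16(k^2+1)N^2(k^2-1)^2(k^4+1)(\alpha^2-\beta^2)-4(k^2+1)^2(k^2-1)^2\big(4k^2(\alpha^2-\beta^2)+6(\alpha^2+\beta^2)+1\big)N^2+\frac98(k^4+1)(k^2+1)^2-6(k^2-1)(k^2+1)^2(k^4+1)(\alpha^2-\beta^2)+\frac18(k^4+1)(k^2-1)^2(8\alpha^2+8\beta^2-1)^2-2(k^2+1)(k^2-1)^2(k^4+1)(\alpha^2-\beta^2)(4\alpha^2+4\beta^2+1)+\frac14(k^4-1)^2\big(32k^2(\alpha^2-\beta^2)-8(\alpha^2+\beta^2)-64\alpha^2\beta^2+32k^2(\alpha^4-\beta^4)-1\big)$. $c_{1,1,1}=-8k^4(N+\frac32)(N-\frac32)\big[(k^2+1)N^2+(k^2-1)(\alpha^2-\beta^2)\big]$. $c_{0,3,0}=-64k^2\big[\frac18(k^2+1)(8k^4-15k^2+8)N^4+\frac9{32}(k^2+1)(k^4+1)+\frac3{64}(k^2+1)(k^2-1)^2\big(11k^2(\alpha^2-\beta^2)-8(\alpha^2+\beta^2)-2\big)-\frac3{64}(k^4+1)(k^2-1)(11k^2+8)(\alpha^2-\beta^2)-\frac{65}{64}(k^4+1)(k^2+1)N^2-\frac1{64}(k^2+1)(k^2-1)^2N^2\big(36k^2(\alpha^2-\beta^2)+32(\alpha^2+\beta^2)-1\big)+\frac{17}{32}N^2(k^2-1)^2(k^4+1)(\alpha^2-\beta^2)+\frac1{32}(k^8-1)N^2(\alpha^2-\beta^2)\big]$.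 $c_{1,2,0}=-32k^2(N+\frac32)\big[-(k^2+1)(k^2-1)^2(\alpha^2+\frac14)N-\frac18(k^4-1)N(\alpha^2-\beta^2+2)+\frac78(k^2-1)^2N(\alpha^2-\beta^2)-\frac14(k^2+1)(N-\frac32)-\frac18(k^2+1)(k^2-1)^2(4\alpha^2-1)-\frac1{16}(k^4-1)(13\alpha^2-13\beta^2-6)-\frac5{16}(k^2-1)^2(\alpha^2-\beta^2)-\frac18(k^2+1)(4k^4+5k^2+4)N^2+\frac14(k^2+1)(4k^4-9k^2+4)N^3\big]$. $c_{0,2,1}=-32k^2(N-\frac32)\big[\frac14(k^2+1)(4k^4-9k^2+4)N^3+\frac18(k^2+1)(4k^4+5k^2+4)N^2+\frac18(k^4-1)\big(k^2(4\alpha^2-1)+5\alpha^2-9\beta^2-2\big)-\frac74(k^2-1)(\alpha^2-\beta^2)(N+\frac5{14})-\frac14(k^4-1)\big(k^2(4\alpha^2+1)-7\alpha^2+3\beta^2\big)N-\frac14(k^2+1)(N+\frac32)\big]$. $c_{1,2,1}=32k^4(N+\frac32)(N-\frac32)\big[(N+\frac12)(N-\frac12)(2k^4+k^2+2)-\frac{k^2}2\big]$. $c_{0,2,2}=16k^4(N-\frac32)^2\big[(\beta+n+\frac12)(2\alpha+\beta+n+\frac12)k^4+(-3N^2+\alpha^2+\beta^2+\frac12)k^2+(\alpha+n+\frac12)(\alpha+2\beta+n+\frac12)\big]$. $c_{2,2,0}=16k^4(N+\frac32)^2\big[(\beta+n-\frac12)(2\alpha+\beta+n-\frac12)k^4+(-3N^2+\alpha^2+\beta^2+\frac12)k^2+(\alpha+n-\frac12)(\alpha+2\beta+n-\frac12)\big]$.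 $c_{0,4,0}=k^4\big[32(3k^4-2k^2+3)N^4-8\big((4\alpha^2+22)k^4+(21-4\alpha^2-4\beta^2)k^2+4\beta^2+22\big)N^2+\frac92(k^4+1)(k^2-1)(8\alpha^2+8\beta^2-1)+\frac{99}2(k^2+1)(k^4+1)-9(k^4-1)\big(4k^2(\alpha^2+\beta^2+\frac54)+4(\alpha^2-\beta^2)\big)\big]$. $c_{1,3,0}=32k^4(N+\frac32)\big[(k^4-6k^2+1)N^3-\frac98(k^4+1)(N-\frac{13}6)+\frac18(k^2-1)N(8k^2\alpha^2-8\beta^2-k^2+1)-\frac1{16}(k^2-1)\big(40k^2\alpha^2-40\beta^2+17(k^2-1)\big)-\frac12(7k^4+12k^2+7)N^2\big]$. $c_{0,3,1}=32k^4(N-\frac32)\big[-\frac98(k^2+1)(N+\frac{13}6)-\frac12(k^4-1)N(\beta^2-\alpha^2+\frac98)+\frac1{16}(k^2-1)^2N(8\alpha^2+8\beta^2-11)+(k^4-6k^2+1)N^3+\frac1{16}(k^2-1)(40k^2\alpha^2-22k^2-40\beta^2-17)+\frac12(7k^4+12k^2+7)N^2\big]$. $c_{1,3,1}=-128k^6(k^2+1)(N+\frac32)(N-\frac32)(N^2-\frac34)$. $c_{1,2,2}=-2k^6(k^2+1)(2N-3)^2(2N+1)(2N+3)$. $c_{2,2,1}=-2k^6(k^2+1)(2N-3)(2N+3)^2(2N-1)$. $c_{0,4,1}=32k^6(k^2+1)(N-\frac32)\big[N^2(N-\frac{19}2)+\frac{11}4N+\frac{39}8\big]$. $c_{1,4,0}=32k^6(k^2+1)(N+\frac32)\big[N^2(N+\frac{19}2)+\frac{11}4N-\frac{39}8\big]$.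 $c_{0,3,2}=2k^6(k^2+1)(2N-3)^2(2N+1)(6N-7)$. $c_{2,3,0}=2k^6(k^2+1)(2N+3)^2(6N+7)(2N-1)$. $c_{0,5,0}=-64k^6(k^2+1)(N+\frac32)(N-\frac32)\big[(N+\frac12)(N-\frac12)-\frac12\big]$. $c_{2,4,0}=-112k^8(N+\frac32)^2\big[N^2+\frac{11}7N-\frac{33}{28}\big]$. $c_{0,4,2}=-112k^8(N-\frac32)^2\big[N(N-\frac{11}7)-\frac{33}{28}\big]$. $c_{3,3,0}=-4k^8(2N-1)(2N+3)^3$. $c_{0,3,3}=-4k^8(2N-3)^3(2N+1)$. $c_{1,4,1}=320k^8(N+\frac32)(N-\frac32)(N^2-\frac{13}{20})$. $c_{1,3,2}=2k^8(2N-3)^2(2N+3)^2$. $c_{2,3,1}=2k^8(2N-3)^2(2N+3)^2$. $c_{2,2,2}=k^8(2N-3)^2(2N+3)^2$. $c_{1,5,0}=-32k^8(N+\frac32)^2\big[N(N+5)-\frac{15}4\big]$. $c_{0,5,1}=-32k^8(N-\frac32)^2\big[N(N-5)-\frac{15}4\big]$. $c_{0,6,0}=k^8(2N-3)^2(2N+3)^2$. *)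

(* Defs.v *)
From mathcomp Require Import all_boot all_order all_algebra.
From mathcomp Require Import all_classical all_reals all_analysis.
Set Implicit Arguments.
Unset Strict Implicit.
Unset Printing Implicit Defensive.
Import Order.TTheory GRing.Theory Num.Theory.
Import numFieldNormedType.Exports.
Local Open Scope classical_set_scope.
Local Open Scope ring_scope.

(* [powR 0 a] is 0 for a != 0, so for alpha < 0 the weight takes the junk
   value 0 at x = 1 and x = -1 only, a null set. *)
Definition weight (R : realType) (alpha beta k x : R) : R :=
  (1 - x ^+ 2) `^ alpha * (1 - k ^+ 2 * x ^+ 2) `^ beta.

(* The integrals are Lebesgue integrals; they are required to be finite, with
   the real values h j (if i = j) and 0 (if i <> j). *)
Definition monic_orthogonal (R : realType) (alpha beta k : R)
    (P : nat -> {poly R}) (h : nat -> R) : Prop :=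
  (forall n, P n \is monic /\ size (P n) = n.+1) /\
  (forall i j,
     (\int[@lebesgue_measure R]_(x in `[(-1)%R, 1%R])
        ((P i).[x] * (P j).[x] * weight alpha beta k x)%R%:E
      = (if i == j then h j else 0%R)%:E)%E).

(* The branch 0 encodes the convention P_(-1) = 0; as it leaves b 0
   unconstrained, b 0 = 0 is imposed separately. *)
Definition recurrence_coef (R : realType)
    (P : nat -> {poly R}) (b : nat -> R) : Prop :=
  b 0%N = 0 /\
  (forall n, 'X * P n =
     P n.+1 + b n *: (if n is m.+1 then P m else 0)).

Section Coefficients.
Context {R : realType} (alpha beta k n : R).
Local Notation N := (alpha + beta + n).

Definition c000 : R :=
  (k ^+ 2 - 1) ^+ 2 * n * (n + 2 * alpha) * (n + 2 * beta)
  * (n + 2 * alpha + 2 * beta).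

Definition c010 : R :=
  alpha ^+ 2 * (- 3 - 4 * beta ^+ 2 + 4 * alpha ^+ 2) * (k ^+ 2 + 1)
    * (k ^+ 2 - 1) ^+ 2 * (2 * N - 3) * (2 * N + 3) * N ^+ 2
  - 2 / 9 * (4 * alpha ^+ 2 - 1) * (alpha ^+ 2 - beta ^+ 2) * (k ^+ 2 + 1)
    * (k ^+ 2 - 1) ^+ 2 * (2 * N - 3) * (2 * N + 3) * (2 * N - 1) * (2 * N + 1)
  - 1 / 9 * (4 * alpha ^+ 4 - 4 * alpha ^+ 2 * beta ^+ 2 - 19 * alpha ^+ 2
             - 8 * beta ^+ 2 + 18)
    * (k ^+ 2 + 1) * (k ^+ 2 - 1) ^+ 2 * (2 * N - 1) * (2 * N + 1) * N ^+ 2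
  + 2 * (k ^+ 2 + 1) * N ^+ 2
  - (alpha ^+ 2 - beta ^+ 2)
    * (16 * n * alpha + 16 * alpha * beta + 1 + 16 * n * beta + 8 * n ^+ 2)
    * (k ^+ 2 - 1) ^+ 2
  + (4 * alpha * beta + 2 * n ^+ 2 - beta ^+ 2 + 5 * alpha ^+ 2
     + 4 * n * alpha + 4 * n * beta)
    * (k ^+ 2 - 1) * (k ^+ 2 + 1).

Definition c011 : R :=
  8 * k ^+ 2 * (N - 3 / 2)
  * ((k ^+ 2 - 1) ^+ 2 * N ^+ 3 + 1 / 2 * (k ^+ 4 + 1) * N ^+ 2
     - (alpha ^+ 2 + beta ^+ 2) * (k ^+ 2 - 1) ^+ 2 * N
     + 1 / 2 * (k ^+ 4 - 1) * (alpha ^+ 2 - beta ^+ 2)).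

Definition c110 : R :=
  8 * k ^+ 2 * (N + 3 / 2)
  * ((k ^+ 2 - 1) ^+ 2 * N ^+ 3 - 1 / 2 * (k ^+ 4 + 1) * N ^+ 2
     - (k ^+ 2 - 1) ^+ 2 * (alpha ^+ 2 + beta ^+ 2) * N
     - 1 / 2 * (k ^+ 4 - 1) * (alpha ^+ 2 - beta ^+ 2)).

Definition c020 : R :=
  - 8 * (k ^+ 4 + 1) * (k ^+ 2 - 1) ^+ 2 * N ^+ 4
  + 24 * (k ^+ 2 + 1) ^+ 2 * (k ^+ 2 - 1) ^+ 2 * N ^+ 4
  - 7 * (k ^+ 4 + 1) * (k ^+ 2 + 1) ^+ 2 * N ^+ 2
  + (k ^+ 4 + 1) * (k ^+ 2 - 1) ^+ 2 * N ^+ 2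
    * (8 * alpha ^+ 2 + 8 * beta ^+ 2 + 3)
  + 16 * (k ^+ 2 + 1) * N ^+ 2 * (k ^+ 2 - 1) ^+ 2 * (k ^+ 4 + 1)
    * (alpha ^+ 2 - beta ^+ 2)
  - 4 * (k ^+ 2 + 1) ^+ 2 * (k ^+ 2 - 1) ^+ 2
    * (4 * k ^+ 2 * (alpha ^+ 2 - beta ^+ 2)
       + 6 * (alpha ^+ 2 + beta ^+ 2) + 1)
    * N ^+ 2
  + 9 / 8 * (k ^+ 4 + 1) * (k ^+ 2 + 1) ^+ 2
  - 6 * (k ^+ 2 - 1) * (k ^+ 2 + 1) ^+ 2 * (k ^+ 4 + 1)
    * (alpha ^+ 2 - beta ^+ 2)
  + 1 / 8 * (k ^+ 4 + 1) * (k ^+ 2 - 1) ^+ 2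
    * (8 * alpha ^+ 2 + 8 * beta ^+ 2 - 1) ^+ 2
  - 2 * (k ^+ 2 + 1) * (k ^+ 2 - 1) ^+ 2 * (k ^+ 4 + 1)
    * (alpha ^+ 2 - beta ^+ 2) * (4 * alpha ^+ 2 + 4 * beta ^+ 2 + 1)
  + 1 / 4 * (k ^+ 4 - 1) ^+ 2
    * (32 * k ^+ 2 * (alpha ^+ 2 - beta ^+ 2) - 8 * (alpha ^+ 2 + beta ^+ 2)
       - 64 * alpha ^+ 2 * beta ^+ 2
       + 32 * k ^+ 2 * (alpha ^+ 4 - beta ^+ 4) - 1).

Definition c111 : R :=
  - 8 * k ^+ 4 * (N + 3 / 2) * (N - 3 / 2)
  * ((k ^+ 2 + 1) * N ^+ 2 + (k ^+ 2 - 1) * (alpha ^+ 2 - beta ^+ 2)).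

Definition c030 : R :=
  - 64 * k ^+ 2
  * (1 / 8 * (k ^+ 2 + 1) * (8 * k ^+ 4 - 15 * k ^+ 2 + 8) * N ^+ 4
     + 9 / 32 * (k ^+ 2 + 1) * (k ^+ 4 + 1)
     + 3 / 64 * (k ^+ 2 + 1) * (k ^+ 2 - 1) ^+ 2
       * (11 * k ^+ 2 * (alpha ^+ 2 - beta ^+ 2)
          - 8 * (alpha ^+ 2 + beta ^+ 2) - 2)
     - 3 / 64 * (k ^+ 4 + 1) * (k ^+ 2 - 1) * (11 * k ^+ 2 + 8)
       * (alpha ^+ 2 - beta ^+ 2)
     - 65 / 64 * (k ^+ 4 + 1) * (k ^+ 2 + 1) * N ^+ 2
     - 1 / 64 * (k ^+ 2 + 1) * (k ^+ 2 - 1) ^+ 2 * N ^+ 2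
       * (36 * k ^+ 2 * (alpha ^+ 2 - beta ^+ 2)
          + 32 * (alpha ^+ 2 + beta ^+ 2) - 1)
     + 17 / 32 * N ^+ 2 * (k ^+ 2 - 1) ^+ 2 * (k ^+ 4 + 1)
       * (alpha ^+ 2 - beta ^+ 2)
     + 1 / 32 * (k ^+ 8 - 1) * N ^+ 2 * (alpha ^+ 2 - beta ^+ 2)).

Definition c120 : R :=
  - 32 * k ^+ 2 * (N + 3 / 2)
  * (- (k ^+ 2 + 1) * (k ^+ 2 - 1) ^+ 2 * (alpha ^+ 2 + 1 / 4) * N
     - 1 / 8 * (k ^+ 4 - 1) * N * (alpha ^+ 2 - beta ^+ 2 + 2)
     + 7 / 8 * (k ^+ 2 - 1) ^+ 2 * N * (alpha ^+ 2 - beta ^+ 2)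
     - 1 / 4 * (k ^+ 2 + 1) * (N - 3 / 2)
     - 1 / 8 * (k ^+ 2 + 1) * (k ^+ 2 - 1) ^+ 2 * (4 * alpha ^+ 2 - 1)
     - 1 / 16 * (k ^+ 4 - 1) * (13 * alpha ^+ 2 - 13 * beta ^+ 2 - 6)
     - 5 / 16 * (k ^+ 2 - 1) ^+ 2 * (alpha ^+ 2 - beta ^+ 2)
     - 1 / 8 * (k ^+ 2 + 1) * (4 * k ^+ 4 + 5 * k ^+ 2 + 4) * N ^+ 2
     + 1 / 4 * (k ^+ 2 + 1) * (4 * k ^+ 4 - 9 * k ^+ 2 + 4) * N ^+ 3).

Definition c021 : R :=
  - 32 * k ^+ 2 * (N - 3 / 2)
  * (1 / 4 * (k ^+ 2 + 1) * (4 * k ^+ 4 - 9 * k ^+ 2 + 4) * N ^+ 3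
     + 1 / 8 * (k ^+ 2 + 1) * (4 * k ^+ 4 + 5 * k ^+ 2 + 4) * N ^+ 2
     + 1 / 8 * (k ^+ 4 - 1)
       * (k ^+ 2 * (4 * alpha ^+ 2 - 1) + 5 * alpha ^+ 2 - 9 * beta ^+ 2 - 2)
     - 7 / 4 * (k ^+ 2 - 1) * (alpha ^+ 2 - beta ^+ 2) * (N + 5 / 14)
     - 1 / 4 * (k ^+ 4 - 1)
       * (k ^+ 2 * (4 * alpha ^+ 2 + 1) - 7 * alpha ^+ 2 + 3 * beta ^+ 2) * N
     - 1 / 4 * (k ^+ 2 + 1) * (N + 3 / 2)).

Definition c121 : R :=
  32 * k ^+ 4 * (N + 3 / 2) * (N - 3 / 2)
  * ((N + 1 / 2) * (N - 1 / 2) * (2 * k ^+ 4 + k ^+ 2 + 2) - k ^+ 2 / 2).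

Definition c022 : R :=
  16 * k ^+ 4 * (N - 3 / 2) ^+ 2
  * ((beta + n + 1 / 2) * (2 * alpha + beta + n + 1 / 2) * k ^+ 4
     + (- 3 * N ^+ 2 + alpha ^+ 2 + beta ^+ 2 + 1 / 2) * k ^+ 2
     + (alpha + n + 1 / 2) * (alpha + 2 * beta + n + 1 / 2)).

Definition c220 : R :=
  16 * k ^+ 4 * (N + 3 / 2) ^+ 2
  * ((beta + n - 1 / 2) * (2 * alpha + beta + n - 1 / 2) * k ^+ 4
     + (- 3 * N ^+ 2 + alpha ^+ 2 + beta ^+ 2 + 1 / 2) * k ^+ 2
     + (alpha + n - 1 / 2) * (alpha + 2 * beta + n - 1 / 2)).

Definition c040 : R :=
  k ^+ 4
  * (32 * (3 * k ^+ 4 - 2 * k ^+ 2 + 3) * N ^+ 4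
     - 8 * ((4 * alpha ^+ 2 + 22) * k ^+ 4
            + (21 - 4 * alpha ^+ 2 - 4 * beta ^+ 2) * k ^+ 2
            + 4 * beta ^+ 2 + 22) * N ^+ 2
     + 9 / 2 * (k ^+ 4 + 1) * (k ^+ 2 - 1)
       * (8 * alpha ^+ 2 + 8 * beta ^+ 2 - 1)
     + 99 / 2 * (k ^+ 2 + 1) * (k ^+ 4 + 1)
     - 9 * (k ^+ 4 - 1)
       * (4 * k ^+ 2 * (alpha ^+ 2 + beta ^+ 2 + 5 / 4)
          + 4 * (alpha ^+ 2 - beta ^+ 2))).

Definition c130 : R :=
  32 * k ^+ 4 * (N + 3 / 2)
  * ((k ^+ 4 - 6 * k ^+ 2 + 1) * N ^+ 3
     - 9 / 8 * (k ^+ 4 + 1) * (N - 13 / 6)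
     + 1 / 8 * (k ^+ 2 - 1) * N
       * (8 * k ^+ 2 * alpha ^+ 2 - 8 * beta ^+ 2 - k ^+ 2 + 1)
     - 1 / 16 * (k ^+ 2 - 1)
       * (40 * k ^+ 2 * alpha ^+ 2 - 40 * beta ^+ 2 + 17 * (k ^+ 2 - 1))
     - 1 / 2 * (7 * k ^+ 4 + 12 * k ^+ 2 + 7) * N ^+ 2).

Definition c031 : R :=
  32 * k ^+ 4 * (N - 3 / 2)
  * (- (9 / 8) * (k ^+ 2 + 1) * (N + 13 / 6)
     - 1 / 2 * (k ^+ 4 - 1) * N * (beta ^+ 2 - alpha ^+ 2 + 9 / 8)
     + 1 / 16 * (k ^+ 2 - 1) ^+ 2 * N
       * (8 * alpha ^+ 2 + 8 * beta ^+ 2 - 11)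
     + (k ^+ 4 - 6 * k ^+ 2 + 1) * N ^+ 3
     + 1 / 16 * (k ^+ 2 - 1)
       * (40 * k ^+ 2 * alpha ^+ 2 - 22 * k ^+ 2 - 40 * beta ^+ 2 - 17)
     + 1 / 2 * (7 * k ^+ 4 + 12 * k ^+ 2 + 7) * N ^+ 2).

Definition c131 : R :=
  - 128 * k ^+ 6 * (k ^+ 2 + 1) * (N + 3 / 2) * (N - 3 / 2)
  * (N ^+ 2 - 3 / 4).

Definition c122 : R :=
  - 2 * k ^+ 6 * (k ^+ 2 + 1) * (2 * N - 3) ^+ 2 * (2 * N + 1) * (2 * N + 3).

Definition c221 : R :=
  - 2 * k ^+ 6 * (k ^+ 2 + 1) * (2 * N - 3) * (2 * N + 3) ^+ 2 * (2 * N - 1).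

Definition c041 : R :=
  32 * k ^+ 6 * (k ^+ 2 + 1) * (N - 3 / 2)
  * (N ^+ 2 * (N - 19 / 2) + 11 / 4 * N + 39 / 8).

Definition c140 : R :=
  32 * k ^+ 6 * (k ^+ 2 + 1) * (N + 3 / 2)
  * (N ^+ 2 * (N + 19 / 2) + 11 / 4 * N - 39 / 8).

Definition c032 : R :=
  2 * k ^+ 6 * (k ^+ 2 + 1) * (2 * N - 3) ^+ 2 * (2 * N + 1) * (6 * N - 7).

Definition c230 : R :=
  2 * k ^+ 6 * (k ^+ 2 + 1) * (2 * N + 3) ^+ 2 * (6 * N + 7) * (2 * N - 1).

Definition c050 : R :=
  - 64 * k ^+ 6 * (k ^+ 2 + 1) * (N + 3 / 2) * (N - 3 / 2)
  * ((N + 1 / 2) * (N - 1 / 2) - 1 / 2).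

Definition c240 : R :=
  - 112 * k ^+ 8 * (N + 3 / 2) ^+ 2 * (N ^+ 2 + 11 / 7 * N - 33 / 28).

Definition c042 : R :=
  - 112 * k ^+ 8 * (N - 3 / 2) ^+ 2 * (N * (N - 11 / 7) - 33 / 28).

Definition c330 : R := - 4 * k ^+ 8 * (2 * N - 1) * (2 * N + 3) ^+ 3.

Definition c033 : R := - 4 * k ^+ 8 * (2 * N - 3) ^+ 3 * (2 * N + 1).

Definition c141 : R :=
  320 * k ^+ 8 * (N + 3 / 2) * (N - 3 / 2) * (N ^+ 2 - 13 / 20).

Definition c132 : R := 2 * k ^+ 8 * (2 * N - 3) ^+ 2 * (2 * N + 3) ^+ 2.

Definition c231 : R := 2 * k ^+ 8 * (2 * N - 3) ^+ 2 * (2 * N + 3) ^+ 2.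

Definition c222 : R := k ^+ 8 * (2 * N - 3) ^+ 2 * (2 * N + 3) ^+ 2.

Definition c150 : R :=
  - 32 * k ^+ 8 * (N + 3 / 2) ^+ 2 * (N * (N + 5) - 15 / 4).

Definition c051 : R :=
  - 32 * k ^+ 8 * (N - 3 / 2) ^+ 2 * (N * (N - 5) - 15 / 4).

Definition c060 : R := k ^+ 8 * (2 * N - 3) ^+ 2 * (2 * N + 3) ^+ 2.

Definition coef (p q r : nat) : R :=
  match p, q, r with
  | 0, 0, 0 => c000
  | 0, 1, 0 => c010
  | 0, 1, 1 => c011
  | 1, 1, 0 => c110
  | 0, 2, 0 => c020
  | 1, 1, 1 => c111
  | 0, 3, 0 => c030
  | 1, 2, 0 => c120
  | 0, 2, 1 => c021
  | 1, 2, 1 => c121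
  | 0, 2, 2 => c022
  | 2, 2, 0 => c220
  | 0, 4, 0 => c040
  | 1, 3, 0 => c130
  | 0, 3, 1 => c031
  | 1, 3, 1 => c131
  | 1, 2, 2 => c122
  | 2, 2, 1 => c221
  | 0, 4, 1 => c041
  | 1, 4, 0 => c140
  | 0, 3, 2 => c032
  | 2, 3, 0 => c230
  | 0, 5, 0 => c050
  | 2, 4, 0 => c240
  | 0, 4, 2 => c042
  | 3, 3, 0 => c330
  | 0, 3, 3 => c033
  | 1, 4, 1 => c141
  | 1, 3, 2 => c132
  | 2, 3, 1 => c231
  | 2, 2, 2 => c222
  | 1, 5, 0 => c150
  | 0, 5, 1 => c051
  | 0, 6, 0 => c060
  | _, _, _ => 0%R
  end%N.

End Coefficients.

(* Main.v *)
From HB Require Import structures.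
Require Import Defs.
From mathcomp Require Import all_boot all_order all_algebra.
From mathcomp Require Import all_classical all_reals all_analysis.
From mathcomp Require Import measurable_realfun ring lra.
Import Order.TTheory GRing.Theory Num.Theory.
Local Open Scope ring_scope.

(** The weight is semiclassical: with sigma = (1 - x^2)(1 - k^2 x^2) it
    satisfies (sigma w)' = tau w for an odd cubic tau.  Writing L f for the
    integral of f w over [-1, 1], integration by parts gives
    L (sigma f' + tau f) = 0 for every polynomial f ([pearson_powR],
    [wint_pearson]); the boundary terms vanish because alpha + 1 > 0.  Since
    w > 0 inside the interval, no h_n vanishes ([wint_sqr_neq0]).  From there
    on the argument is algebraic.

    Put s_n = b_0 + ... + b_(n-1), so that P_n = x^n - s_n x^(n-2) + ....
    Differentiating the recurrence x P_n = P_(n+1) + b_n P_(n-1) and testing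
    against P_n, with integration by parts for the two terms whose expansion
    would involve deeper coefficients of P_n, gives one relation between the
    b_j and s_n ([string_equation]), the string equation.

    The ladder relation P_n' = b_n A_n P_(n-1) - B_n P_n has, for this weight,
      A_n = R_n / (1 - x^2) + k^2 S_n / (1 - k^2 x^2),
      B_n = x (r_n / (1 - x^2) + k^2 (n - r_n) / (1 - k^2 x^2)),
    with R_n = r_(n+1) + r_n + 2 alpha and S_n = 2 (alpha + beta + n) + 1 - R_n.
    Comparing residues expresses r_n by b_n and s_n, and that expression is
    taken as the definition of r_n.  The string equation then reads
      r_(n+1) - r_n = b_(n+1) R_(n+1) - b_n R_(n-1).
    Multiplied by R_n, it says that both sides of
      r_n (r_n + 2 alpha) = b_n R_n R_(n-1)
    have the same increment; the companion relation at x^2 = 1/k^2, multiplied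
    by S_n, does the same for
      (n - r_n) (n - r_n + 2 beta) = k^2 b_n S_n S_(n-1).
    Both identities therefore hold by induction ([ladder_quadratic_at_1],
    [ladder_quadratic_at_inv_k]).  The sum s_n drops out of the differences
    r_(n+1) - r_n and r_n - r_(n-1): they are of degree one in b_(n+1), b_n,
    b_(n-1) ([ladder_r_diff]).  So both identities are quadratic equations for
    the single unknown rho = r_n + alpha, with coefficients polynomial in these
    three b's.  Their resultant vanishes, and (1 - k^2)^2 times the resultant
    is the announced polynomial ([difference_polynomial_resultant]). *)

(** * Orthogonal polynomials for a semiclassical functional *)

(** This is (2 L (sigma P_n' P_(n+1)) + L (tau P_n P_(n+1))) / h_(n+1), as
    [L_string_term] shows, when s is the sequence of partial sums of b. *)
Definition string_term {F : fieldType} (alpha beta K : F) (b s : nat -> F)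
    (n : nat) : F :=
  2 * (K * n%:R * s n.+3 - (1 + K) * n%:R - K * (n%:R - 2) * s n)
  - (2 * (alpha + 1) + 2 * (beta + 1) * K)
  + 2 * K * (alpha + beta + 2) * (b n + b n.+1 + b n.+2).

Section OrthogonalPolynomials.
Context {F : fieldType}.
Variables (L : {scalar {poly F}}) (P : nat -> {poly F}) (h b : nat -> F).

Definition prevP n : {poly F} := if n is m.+1 then P m else 0.
Definition bsum n : F := \sum_(j < n) b j.

Hypothesis sizeP : forall n, size (P n) = n.+1.
Hypothesis monP : forall n, P n \is monic.
Hypothesis orthP : forall i j, L (P i * P j) = if i == j then h j else 0.
Hypothesis b0 : b 0%N = 0.
Hypothesis recP : forall n, 'X * P n = P n.+1 + b n *: prevP n.

Lemma LZ a p : L (a *: p) = a * L p.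
Proof. exact: linearZ. Qed.

Lemma bsumS n : bsum n.+1 = bsum n + b n.
Proof. by rewrite /bsum big_ord_recr. Qed.

Lemma bsum0 : bsum 0 = 0.
Proof. by rewrite /bsum big_ord0. Qed.

Lemma bsum1 : bsum 1 = 0.
Proof. by rewrite bsumS bsum0 b0 addr0. Qed.

Lemma coefP_gt n i : (n < i)%N -> (P n)`_i = 0.
Proof. by move=> ni; rewrite nth_default ?sizeP. Qed.

Lemma coefP_lead n : (P n)`_n = 1.
Proof. by have /monicP := monP n; rewrite /lead_coef sizeP. Qed.

Lemma P_succ n : P n.+1 = 'X * P n - b n *: prevP n.
Proof. by rewrite recP addrK. Qed.

Lemma coefP_sub1 n : (P n.+1)`_n = 0.
Proof.
elim: n => [|n IHn]; rewrite P_succ coefB coefXM coefZ /=.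
  by rewrite b0 mul0r subr0.
by rewrite IHn coefP_gt ?mulr0 ?subr0.
Qed.

(** Passing from P_n to P_(n+1), the recurrence adds - b_n to the coefficient
    two below the leading one. *)
Lemma coefP_sub2 n : (P n.+2)`_n = - bsum n.+2.
Proof.
elim: n => [|n IHn]; rewrite P_succ coefB coefXM coefZ /=.
  by rewrite coefP_lead bsumS bsum1 mulr1 sub0r add0r.
by rewrite IHn coefP_lead mulr1 [bsum n.+3]bsumS opprD.
Qed.

(** Shifting by a power of X makes the two coefficient formulas valid for every
    n: in low degree both sides are zero, as b_0 = 0. *)
Lemma coefXP n : ('X * P n)`_n = 0.
Proof. by rewrite coefXM; case: n => //= n; rewrite coefP_sub1. Qed.

Lemma coefX2P n : ('X^2 * P n)`_n = - bsum n.
Proof.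
rewrite coefXnM; case: n => [|[|n]] /=; rewrite ?bsum0 ?bsum1 ?oppr0 //.
by rewrite subn2 /= coefP_sub2.
Qed.

Lemma size_lower (f : {poly F}) d :
  (size f <= d.+1)%N -> f`_d = 0 -> (size f <= d)%N.
Proof.
move=> /leq_sizeP sf fd; apply/leq_sizeP => j.
by rewrite leq_eqVlt => /predU1P[<-//|]; exact: sf.
Qed.

Lemma size_subP (f : {poly F}) d :
  (size f <= d.+1)%N -> (size (f - f`_d *: P d)%R <= d)%N.
Proof.
move=> sf; apply: size_lower.
  rewrite (leq_trans (size_polyD _ _)) // geq_max sf size_polyN.
  by rewrite (leq_trans (size_scale_leq _ _)) ?sizeP.
by rewrite coefB coefZ coefP_lead mulr1 subrr.
Qed.

Lemma L_lower m (f : {poly F}) : (size f <= m)%N -> L (f * P m) = 0.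
Proof.
have: (m <= m)%N by [].
(* Induction on a bound d for the size of f, separated from m. *)
move: {1 3}m => d; elim: d f => [|d IHd] f dm sf.
  by move: sf; rewrite leqn0 size_poly_eq0 => /eqP ->; rewrite mul0r linear0.
rewrite -(subrK (f`_d *: P d) f) mulrDl linearD IHd ?(ltnW dm) ?size_subP //.
by rewrite -scalerAl LZ orthP (ltn_eqF dm) mulr0 addr0.
Qed.

Lemma L_top m (f : {poly F}) : (size f <= m.+1)%N -> L (f * P m) = f`_m * h m.
Proof.
move=> sf; rewrite -{1}(subrK (f`_m *: P m) f) mulrDl linearD.
by rewrite L_lower ?size_subP // add0r -scalerAl LZ orthP eqxx.
Qed.

(** The polynomials tested below exceed the degree of P_m by two and, by parity,
    have no term of degree m + 1; subtracting a multiple of P_(m+2) then reduces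
    the degree to m. *)
Lemma L_top2 m (f : {poly F}) : (size f <= m.+3)%N -> f`_m.+1 = 0 ->
  L (f * P m) = (f`_m + f`_m.+2 * bsum m.+2) * h m.
Proof.
move=> sf f1; rewrite -{1}(subrK (f`_m.+2 *: P m.+2) f) mulrDl linearD.
rewrite -scalerAl LZ orthP gtn_eqF // mulr0 addr0 L_top.
  by rewrite coefB coefZ coefP_sub2 mulrN opprK.
apply: size_lower; first exact: size_subP.
by rewrite coefB coefZ f1 coefP_sub1 mulr0 subrr.
Qed.

Lemma sizeMP k n m (g : {poly F}) : (size g <= k.+1)%N -> (n + k < m)%N ->
  (size (g * P n)%R <= m)%N.
Proof.
move=> sg; apply: leq_trans; apply: leq_trans (size_polyMleq _ _) _.
by rewrite sizeP addnS /= addnC -addnS leq_add2l.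
Qed.

Lemma L_XPP n : L ('X * P n * P n.+1) = h n.+1.
Proof.
rewrite L_top; last by rewrite (sizeMP 1) ?size_polyX ?addn1.
by rewrite coefXM /= coefP_lead mul1r.
Qed.

Lemma h_succ n : h n.+1 = b n.+1 * h n.
Proof.
rewrite -L_XPP mulrAC recP mulrDl linearD -scalerAl /= LZ.
by rewrite !orthP eqxx gtn_eqF // add0r.
Qed.

Lemma L_X3PP n :
  L ('X^3 * P n * P n.+1) = (b n + b n.+1 + b n.+2) * h n.+1.
Proof.
rewrite L_top2; last 2 first.
- by rewrite (sizeMP 3) ?size_polyXn ?addn3.
- by rewrite exprS -mulrA coefXM /= exprS -mulrA coefXM /= coefXP.
rewrite exprS -mulrA !coefXM /= coefX2P coefXnM /= subn2 /= coefP_lead.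
by rewrite !bsumS; ring.
Qed.

Lemma L_X2PP n : L ('X^2 * P n * P n) = (b n + b n.+1) * h n.
Proof.
have -> : 'X^2 * P n * P n = 'X * P n * ('X * P n) by ring.
rewrite [in X in _ * X]recP.
rewrite mulrDr linearD /= L_XPP h_succ -scalerAr LZ.
case: n => [|n]; first by rewrite b0 /= mul0r addr0 add0r.
by rewrite /= -mulrA [P _ * P _]mulrC mulrA L_XPP; ring.
Qed.

Lemma L_X4PP n : L ('X^4 * P n * P n) =
  (b n.+1 * (b n + b n.+1 + b n.+2) + b n * (b n.-1 + b n + b n.+1)) * h n.
Proof.
have -> : 'X^4 * P n * P n = 'X^3 * P n * ('X * P n) by ring.
rewrite recP.
rewrite mulrDr linearD /= L_X3PP h_succ -scalerAr LZ.
case: n => [|n]; first by rewrite b0 /=; ring.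
by rewrite /= [_ * P n.+1 * _]mulrAC L_X3PP; ring.
Qed.

Lemma coef_euler (p : {poly F}) i : ('X * p^`())`_i = i%:R * p`_i.
Proof.
by rewrite coefXM; case: i => [|i] /=; rewrite ?mul0r// coef_deriv mulr_natl.
Qed.

Section Semiclassical.
Variables (alpha beta K : F).

Definition sigma : {poly F} := (1 - 'X^2) * (1 - K *: 'X^2).
Definition tau : {poly F} :=
  - (2 * (alpha + 1)) *: ('X * (1 - K *: 'X^2))
  - (2 * (beta + 1) * K) *: ('X * (1 - 'X^2)).

Hypothesis pearson : forall f : {poly F}, L (sigma * f^`() + tau * f) = 0.
Hypothesis h_neq0 : forall n, h n != 0.

Lemma sigmaE : sigma = 1 - (1 + K) *: 'X^2 + K *: 'X^4.
Proof. rewrite /sigma -!mul_polyC polyCD; ring. Qed.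

Lemma tauE : tau =
  - (2 * (alpha + 1) + 2 * (beta + 1) * K) *: 'X
  + (2 * K * (alpha + beta + 2)) *: 'X^3.
Proof.
by rewrite /tau -!mul_polyC !(polyCN, polyCD, polyCM); ring.
Qed.

Lemma coefXnMl k (p : {poly F}) i : ('X^k * p)`_(k + i) = p`_i.
Proof. by rewrite coefXnM ltnNge leq_addr addKn. Qed.

(** The coefficients of sigma P_n' are read off after multiplication by X,
    since X P_n' has the coefficients i (P_n)_i. *)
Lemma L_sigma_dPP n : L (sigma * (P n)^`() * P n.+1) =
  (K * n%:R * bsum n.+3 - (1 + K) * n%:R - K * (n%:R - 2) * bsum n) * h n.+1.
Proof.
pose E := 'X * (P n)^`().
have E_hi i : (n < i)%N -> E`_i = 0.
  by move=> ni; rewrite coef_euler coefP_gt ?mulr0.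
have E_n : E`_n = n%:R by rewrite coef_euler coefP_lead mulr1.
have E_n1 : ('X * E)`_n = 0.
  rewrite coefXM coef_euler; case: (n) => //= m.
  by rewrite coefP_sub1 mulr0.
have E_n2 : ('X^2 * E)`_n = - (n%:R - 2) * bsum n.
  rewrite coefXnM coef_euler; have := coefX2P n; rewrite coefXnM.
  case: ltnP => [_ /eqP|n2 ->]; last by rewrite natrB // mulrN mulNr.
  by rewrite eq_sym oppr_eq0 => /eqP ->; rewrite mulr0.
have coefE i : (sigma * (P n)^`())`_i =
    E`_i.+1 - (1 + K) * ('X^2 * E)`_i.+1 + K * ('X^4 * E)`_i.+1.
  have -> : (sigma * (P n)^`())`_i = ('X * (sigma * (P n)^`()))`_i.+1.
    by rewrite coefXM.
  have -> : 'X * (sigma * (P n)^`()) =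
      E - (1 + K) *: ('X^2 * E) + K *: ('X^4 * E).
    by rewrite sigmaE /E -!mul_polyC; ring.
  by rewrite coefD coefB !coefZ.
have X4_3 : 'X^4 * E = 'X^3 * ('X * E) by ring.
have X4_2 : 'X^4 * E = 'X^2 * ('X^2 * E) by ring.
rewrite L_top2 ?coefE.
- rewrite (coefXnMl 2 E n) (coefXnMl 2 E n.+2) (coefXnMl 4 E n).
  by rewrite X4_2 (coefXnMl 2 _ n) E_n2 E_n !E_hi ?ltnS ?leqW //; ring.
- have s_le : (size sigma <= 5)%N.
    apply/leq_sizeP => i i5.
    rewrite sigmaE !(coefD, coefN, coefZ, coef1, coefXn).
    by rewrite !gtn_eqF ?(leq_trans _ i5) // !mulr0 oppr0 !addr0.
  apply: leq_trans (size_polyMleq _ _) _; rewrite -subn1 leq_subLR add1n.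
  have d_le : (size ((P n)^`())%R <= n)%N.
    by rewrite -ltnS -(sizeP n) lt_size_deriv // -size_poly_eq0 sizeP.
  by apply: leq_trans (leq_add s_le d_le) _; rewrite !addSn add0n.
rewrite X4_3 (coefXnMl 2 E n.+1) (coefXnMl 3 _ n) E_n1 !E_hi ?ltnS ?leqW //.
by rewrite !mulr0 subr0 addr0.
Qed.

Lemma L_string_term n :
  2 * L (sigma * (P n)^`() * P n.+1) + L (tau * P n * P n.+1)
  = string_term alpha beta K b bsum n * h n.+1.
Proof.
have -> : tau * P n * P n.+1 =
    - (2 * (alpha + 1) + 2 * (beta + 1) * K) *: ('X * P n * P n.+1)
    + (2 * K * (alpha + beta + 2)) *: ('X^3 * P n * P n.+1).
  by rewrite tauE !mulrDl -!scalerAl.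
by rewrite L_sigma_dPP linearD /= !LZ L_XPP L_X3PP /string_term; ring.
Qed.

Lemma L_sigmaPP n : L (sigma * P n * P n) =
  (1 - (1 + K) * (b n + b n.+1)
   + K * (b n.+1 * (b n + b n.+1 + b n.+2) + b n * (b n.-1 + b n + b n.+1)))
  * h n.
Proof.
have -> : sigma * P n * P n =
    P n * P n - (1 + K) *: ('X^2 * P n * P n) + K *: ('X^4 * P n * P n).
  by rewrite sigmaE !mulrDl !mulNr -!scalerAl mul1r.
by rewrite linearD linearB /= !LZ L_X2PP L_X4PP orthP eqxx; ring.
Qed.

(** The recurrence multiplied by sigma, differentiated and tested against P_n.
    The products P_n P_(n+1) and P_n P_(n-1) are fed to the Pearson identity so
    that only the derivative of the lower polynomial remains. *)
Lemma string_equation n :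
  1 - (1 + K) * (b n + b n.+1)
   + K * (b n.+1 * (b n + b n.+1 + b n.+2) + b n * (b n.-1 + b n + b n.+1))
   + b n.+1 * string_term alpha beta K b bsum n
   - b n * string_term alpha beta K b bsum n.-1 = 0.
Proof.
have pear f g :
    L (sigma * f^`() * g) + L (sigma * g^`() * f) + L (tau * f * g) = 0.
  rewrite -!linearD -[RHS](pearson (f * g)) derivM; congr (L _); ring.
have dX : sigma * P n * P n + sigma * (P n)^`() * ('X * P n)
    = sigma * (P n.+1)^`() * P n + b n *: (sigma * (prevP n)^`() * P n).
  have := congr1 (fun p : {poly F} => p^`()) (recP n).
  rewrite derivM derivX derivD derivZ => e.
  transitivity (sigma * P n * (1 * P n + 'X * (P n)^`())); first by ring.
  by rewrite e -!mul_polyC; ring.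
have := congr1 L dX.
rewrite recP mulrDr !linearD /= -scalerAr !LZ L_sigmaPP => e.
have p1 := pear (P n) (P n.+1).
have p0 := pear (P n) (prevP n).
have w1 := L_string_term n.
have w0 : b n * (2 * L (sigma * (prevP n)^`() * P n) + L (tau * P n * prevP n))
    = b n * string_term alpha beta K b bsum n.-1 * h n.
  case: (n) => [|m]; first by rewrite b0 !mul0r.
  have -> : tau * P m.+1 * prevP m.+1 = tau * P m * P m.+1 by rewrite mulrAC.
  by rewrite L_string_term mulrA.
apply: (mulIf (h_neq0 n)); rewrite mul0r.
rewrite h_succ in w1.
move: e p1 p0 w1 w0.
set S := 1 - _ + _.
move: (L (sigma * (P n)^`() * P n.+1)) (L (sigma * (P n)^`() * prevP n))
  (L (sigma * (P n.+1)^`() * P n)) (L (sigma * (prevP n)^`() * P n))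
  (L (tau * P n * P n.+1)) (L (tau * P n * prevP n)).
move=> u1 d0 d1 u0 t1 t0 e p1 p0 w1 w0.
transitivity ((S * h n + (u1 + b n * d0) - (d1 + b n * u0))
  + (u1 + d1 + t1) - b n * (d0 + u0 + t0)
  - ((2 * u1 + t1) - string_term alpha beta K b bsum n * (b n.+1 * h n))
  + (b n * (2 * u0 + t0) - b n * string_term alpha beta K b bsum n.-1 * h n)).
  by ring.
by rewrite e p1 p0 w1 w0; ring.
Qed.

End Semiclassical.
End OrthogonalPolynomials.

(** * From the string equation to two quadratic equations *)

Section LadderCoefficients.
Context {F : fieldType}.
Variables (alpha beta K : F) (b s : nat -> F).
Hypothesis K_neq1 : 1 - K != 0.
Hypothesis b0 : b 0%N = 0.
Hypothesis s0 : s 0%N = 0.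
Hypothesis sS : forall n, s n.+1 = s n + b n.

Let N n : F := alpha + beta + n%:R.

Hypothesis string : forall n,
  1 - (1 + K) * (b n + b n.+1)
   + K * (b n.+1 * (b n + b n.+1 + b n.+2) + b n * (b n.-1 + b n + b n.+1))
   + b n.+1 * string_term alpha beta K b s n
   - b n * string_term alpha beta K b s n.-1 = 0.

(** The residues of the ladder coefficients at x^2 = 1 ([ladder_r], [ladder_R])
    and at x^2 = 1/K ([ladder_S]).  The formula for [ladder_r] comes from
    summing [ladder_r_diff], in which the quadratic terms of the two residue
    relations [ladder_string_at_1] and [ladder_string_at_inv_k] have been
    eliminated. *)
Definition ladder_r n : F :=
  (n%:R - K * ((2 * N n + 1) * b n + 2 * s n)) / (1 - K).
Definition ladder_R n : F := ladder_r n.+1 + ladder_r n + 2 * alpha.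
Definition ladder_S n : F := 2 * N n + 1 - ladder_R n.

Lemma ladder_r0 : ladder_r 0 = 0.
Proof. by rewrite /ladder_r b0 s0; ring. Qed.

Lemma ladder_r_diff n : (1 - K) * (ladder_r n.+1 - ladder_r n) =
  1 - K * ((2 * N n + 3) * b n.+1 - (2 * N n - 1) * b n).
Proof. by rewrite /ladder_r sS /N -(natr1 n); field. Qed.

(** The string equation divided by 1 - K. *)
Lemma ladder_string_at_1 n :
  ladder_r n.+1 - ladder_r n = b n.+1 * ladder_R n.+1 - b n * ladder_R n.-1.
Proof.
apply/eqP; rewrite -subr_eq0; apply/eqP.
transitivity ((1 - K)^-1 * 0); last by rewrite mulr0.
rewrite -[in RHS](string n) /string_term /ladder_R.
(* At n = 0 the term with index n - 1 is only formal: it carries b_0 = 0. *)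
case: n => [|n] /=.
  by rewrite /ladder_r !sS s0 b0 /N; field.
rewrite /ladder_r !sS /N.
by rewrite -!(natr1 n.+3, natr1 n.+2, natr1 n.+1, natr1 n); field.
Qed.

(** As R_n + S_n is explicit, this combines [ladder_r_diff] with K times
    [ladder_string_at_1]. *)
Lemma ladder_string_at_inv_k n :
  1 - (ladder_r n.+1 - ladder_r n) =
  K * (b n.+1 * ladder_S n.+1 - b n * ladder_S n.-1).
Proof.
have r1 := ladder_r_diff n; have r2 := ladder_string_at_1 n.
have -> : K * (b n.+1 * ladder_S n.+1 - b n * ladder_S n.-1) =
   K * ((2 * N n + 3) * b n.+1 - (2 * N n - 1) * b n)
   - K * (b n.+1 * ladder_R n.+1 - b n * ladder_R n.-1).
  case: n {r1 r2} => [|n]; rewrite /ladder_S /N /= ?b0; first by ring.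
  by rewrite -!natr1; ring.
rewrite -r2; move: r1; set X := K * (_ - _) => r1.
have -> : X = 1 - (1 - K) * (ladder_r n.+1 - ladder_r n) by rewrite r1; ring.
by ring.
Qed.

(** The increment of r_n (r_n + 2 alpha) is (r_(n+1) - r_n) R_n, and the string
    equation turns it into the increment of b_n R_n R_(n-1). *)
Lemma ladder_quadratic_at_1 n :
  ladder_r n * (ladder_r n + 2 * alpha) = b n * ladder_R n * ladder_R n.-1.
Proof.
elim: n => [|n IHn]; first by rewrite ladder_r0 b0 !mul0r.
have -> : ladder_r n.+1 * (ladder_r n.+1 + 2 * alpha) =
    (ladder_r n.+1 - ladder_r n) * ladder_R n
    + ladder_r n * (ladder_r n + 2 * alpha).
  by rewrite /ladder_R; ring.
by rewrite ladder_string_at_1 IHn /=; ring.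
Qed.

(** The same argument for n - r_n, alpha being replaced by beta. *)
Lemma ladder_quadratic_at_inv_k n :
  (n%:R - ladder_r n) * (n%:R - ladder_r n + 2 * beta) =
  K * (b n * ladder_S n * ladder_S n.-1).
Proof.
elim: n => [|n IHn]; first by rewrite ladder_r0 b0 subr0 !(mul0r, mulr0).
have -> : (n.+1%:R - ladder_r n.+1) * (n.+1%:R - ladder_r n.+1 + 2 * beta) =
    (1 - (ladder_r n.+1 - ladder_r n)) * ladder_S n
    + (n%:R - ladder_r n) * (n%:R - ladder_r n + 2 * beta).
  by rewrite /ladder_S /ladder_R /N -(natr1 n); ring.
by rewrite ladder_string_at_inv_k IHn /=; ring.
Qed.

End LadderCoefficients.

(** * The weight functional *)

Section Analysis.
Import numFieldNormedType.Exports.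
Local Open Scope classical_set_scope.
Local Open Scope ring_scope.

Lemma is_derive_horner_powR (R : realType) (u : {poly R}) (a x : R) :
  0 < u.[x] ->
  is_derive x 1 (fun y => u.[y] `^ (a + 1))
    ((a + 1) * u.[x] `^ a * u^`().[x]).
Proof.
move=> ux0.
have H : is_derive u.[x] 1 (fun y => y `^ (a + 1)) ((a + 1) * u.[x] `^ a).
  by have := is_derive1_powR (a + 1) ux0; rewrite addrK.
have H2 : is_derive x 1 (horner u) u^`().[x] by exact: is_derive_poly.
exact: is_derive1_comp.
Qed.

Lemma powR_succ (R : realType) (y a : R) : 0 < y -> y `^ (a + 1) = y `^ a * y.
Proof.
move=> y0; rewrite powRD; first by rewrite powRr1 ?ltW.
by rewrite (gt_eqF y0) implybT.
Qed.

Lemma horner_powR_continuous (R : realType) (u : {poly R}) (a x : R) :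
  0 < u.[x] -> {for x, continuous (fun y => u.[y] `^ a)}.
Proof.
move=> ux0; rewrite -(subrK 1 a).
apply/differentiable_continuous/derivable1_diffP.
by apply: ex_derive; exact: is_derive_horner_powR.
Qed.

(** [powR] is continuous at 0 only from the right, whence the positivity of u
    along the filter. *)
Lemma horner_powR_cvg0 (R : realType) (u : {poly R}) (a x : R)
    (F : set_system R) :
  Filter F -> (forall A, nbhs x A -> F A) -> 0 < a -> u.[x] = 0 ->
  (\forall y \near F, 0 < u.[y]) -> u.[y] `^ a @[y --> F] --> 0.
Proof.
move=> FF Fx a0 ux0 upos.
apply: (@cvg_comp _ _ _ (horner u) (fun y => y `^ a) F 0^'+).
  2: exact: powR_cvg0.
move=> A; rewrite /= !nbhs_simpl /= => nA.
have : nbhs u.[x] [set y | 0 < y -> A y] by rewrite ux0.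
move=> /(@continuous_horner R u x) /Fx nB.
by apply: filterS2 nB upos => y /=; apply.
Qed.

(** The integrand g is the derivative of G = f u^(al+1) v^(be+1), which vanishes
    at both ends.  As g may be unbounded there, the fundamental theorem of
    calculus is applied in the open interval only: G and the primitive I of g
    are continuous on [a, b] and have the same derivative inside, so G - I is
    constant. *)
Lemma pearson_powR (R : realType) (a b al be : R) (u v f : {poly R}) :
  let mu := @lebesgue_measure R in
  let g (x : R) :=
    (u * v * f^`()
     + ((al + 1) *: (u^`() * v) + (be + 1) *: (u * v^`())) * f).[x]
    * (u.[x] `^ al * v.[x] `^ be) in
  a < b -> 0 < al + 1 -> u.[a] = 0 -> u.[b] = 0 ->
  {in `]a, b[, forall x, 0 < u.[x]} -> {in `[a, b], forall x, 0 < v.[x]} ->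
  mu.-integrable `[a, b] (EFin \o g) ->
  \int[mu]_(x in `[a, b]) g x = 0.
Proof.
move=> mu g ab al0 ua ub upos vpos gint.
pose G x := f.[x] * (u.[x] `^ (al + 1) * v.[x] `^ (be + 1)).
pose I x := parameterized_integral mu a x g.
have vpos' x : x \in `]a, b[ -> 0 < v.[x].
  by move=> xab; apply: vpos; move: x xab; exact: subset_itv_oo_cc.
have dG x : x \in `]a, b[ -> is_derive x 1 G (g x).
  move=> xab; have ux := upos _ xab; have vx := vpos' _ xab.
  have du := is_derive_horner_powR _ u al x ux.
  have dv := is_derive_horner_powR _ v be x vx.
  have df : is_derive x 1 (horner f) f^`().[x] by exact: is_derive_poly.
  rewrite /G.
  apply: is_derive_eq.
  rewrite /g !(hornerD, hornerM, hornerZ) /GRing.scale /=.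
  by rewrite !powR_succ //; ring.
have dI x : x \in `]a, b[ -> is_derive x 1 I (g x).
  move=> xab; have [ax xb] : a < x /\ x < b.
    by move: xab; rewrite in_itv /= => /andP[].
  have cg : {for x, continuous g}.
    apply: continuousM; first exact: continuous_horner.
    apply: continuousM; apply: horner_powR_continuous; first exact: upos.
    exact: vpos'.
  have [dIx Ix] := continuous_FTC1_closed xb gint ax cg.
  by apply: DeriveDef => //; rewrite -derive1E.
have cG : {within `[a, b], continuous G}.
  apply/(continuous_within_itvP _ ab).
  have cv x : x \in `[a, b] -> {for x, continuous (fun y => v.[y] `^ (be + 1))}.
    by move=> xab; apply: horner_powR_continuous; exact: vpos.
  split.
  - move=> x xab; apply/differentiable_continuous/derivable1_diffP.
    by apply: ex_derive; exact: dG.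
  - rewrite /G ua powR0 ?gt_eqF // mul0r.
    apply: cvgM; first by apply: cvg_at_right_filter; exact: continuous_horner.
    rewrite -(mul0r (v.[a] `^ (be + 1))); apply: cvgM; last first.
      by apply: cvg_at_right_filter; apply: cv; rewrite in_itv /= lexx ltW.
    apply: (@horner_powR_cvg0 _ _ _ a) => //.
      by move=> A nA; apply: cvg_at_right_filter nA; exact: cvg_id.
    near=> y; apply: upos; rewrite in_itv /=; apply/andP; split; near: y.
      exact: nbhs_right_gt.
    exact: nbhs_right_lt.
  - rewrite /G ub powR0 ?gt_eqF // mul0r.
    apply: cvgM; first by apply: cvg_at_left_filter; exact: continuous_horner.
    rewrite -(mul0r (v.[b] `^ (be + 1))); apply: cvgM; last first.
      by apply: cvg_at_left_filter; apply: cv; rewrite in_itv /= lexx ltW.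
    apply: (@horner_powR_cvg0 _ _ _ b) => //.
      by move=> A nA; apply: cvg_at_left_filter nA; exact: cvg_id.
    near=> y; apply: upos; rewrite in_itv /=; apply/andP; split; near: y.
      exact: nbhs_left_gt.
    exact: nbhs_left_lt.
have cI : {within `[a, b], continuous I}.
  by apply: parameterized_integral_continuous => //; exact: ltW.
have dGI x : x \in `]a, b[ -> is_derive x 1 (G \- I) 0.
  move=> xab; have := dG x xab; have := dI x xab => ? ?.
  by apply: is_derive_eq; rewrite subrr.
have cGI : {within `[a, b], continuous (G \- I)}.
  by move=> x; apply: cvgB; [exact: cG|exact: cI].
have [c _] := MVT ab dGI cGI.
rewrite mul0r /= /G ua ub !powR0 ?gt_eqF // !mul0r !mulr0 !sub0r.
rewrite /I /parameterized_integral set_itv1 Rintegral_set1 oppr0 subr0.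
by move/eqP; rewrite oppr_eq0 => /eqP.
Unshelve. all: by end_near. Qed.

Lemma exists_nonroot_itv (R : realType) (p : {poly R}) : p != 0 ->
  exists2 x, x \in `](-1), 1[ & p.[x] != 0.
Proof.
move=> p0.
(* More candidates 1/2, 1/3, ... than p can have roots. *)
pose rs := [seq i.+2%:R^-1 : R | i <- iota 0 (size p)].
have urs : uniq rs.
  rewrite map_inj_uniq ?iota_uniq // => i j /invr_inj /eqP.
  by rewrite eqr_nat => /eqP [].
have /allPn[_ /mapP[i _ ->] px0] : ~~ all (root p) rs.
  apply/negP => rp; have := max_poly_roots p0 rp urs.
  by rewrite size_map size_iota ltnn.
have i0 : (0 : R) < i.+2%:R^-1 by rewrite invr_gt0.
exists i.+2%:R^-1 => //; rewrite in_itv /= (lt_trans _ i0) ?ltrN10 //=.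
by rewrite invf_lt1 // ltr1n.
Qed.

Section WeightFunctional.
Context {R : realType} (alpha beta k : R).
Hypothesis k2 : 0 < k ^+ 2 < 1.
Let mu := @lebesgue_measure R.
Local Notation J := (`[(-1)%R, 1%R]%classic : set (measurableTypeR R)).
Local Notation w := (weight alpha beta k).
Hypothesis w_int : mu.-integrable J (EFin \o w).

Definition wint (f : {poly R}) : R := \int[mu]_(x in J) (f.[x] * w x).

Lemma integrable_poly_weight (f : {poly R}) :
  mu.-integrable J (EFin \o (fun x => f.[x] * w x)).
Proof.
apply: (@integrableMr _ _ _ mu J _ (horner f) (EFin \o w)) => //.
- exact: measurable_poly.
- have cf : {within J, continuous (horner f)}.
    by apply: continuous_subspaceT; exact: continuous_horner.
  have /compact_bounded[M [_ Mf]] :=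
    continuous_compact cf (@segment_compact _ _ _).
  exists M; split; rewrite ?num_real // => M' MM' x Jx.
  by apply: Mf => //; exists x.
Qed.

Lemma wint_scalar : scalar wint.
Proof.
move=> c f g; rewrite /wint.
rewrite -RintegralZl //; last exact: integrable_poly_weight.
rewrite -RintegralD //; last 2 first.
- rewrite [X in mu.-integrable _ X](_ : _ =
      EFin \o (fun x => (c *: f).[x] * w x)).
    exact: integrable_poly_weight.
  by apply/funext => x /=; rewrite hornerZ mulrA.
- exact: integrable_poly_weight.
apply: eq_Rintegral => x _; rewrite hornerD hornerZ; ring.
Qed.

Lemma one_sub_sqr_gt0 (x : R) : x \in `](-1), 1[ -> 0 < 1 - x ^+ 2.
Proof.
rewrite in_itv /= => /andP[x1 x2].
have -> : 1 - x ^+ 2 = (1 - x) * (1 + x) by ring.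
by apply: mulr_gt0; lra.
Qed.

Lemma one_sub_k2_sqr_gt0 (x : R) : x \in `[(-1), 1] -> 0 < 1 - k ^+ 2 * x ^+ 2.
Proof.
case/andP: k2 => k0 k1; rewrite in_itv /= => xJ.
rewrite subr_gt0; apply: (le_lt_trans _ k1); apply: ler_piMr; first exact: ltW.
by rewrite -[x ^+ 2]real_normK ?num_real // expr_le1 // ler_norml.
Qed.

Lemma weight_gt0 (x : R) : x \in `](-1), 1[ -> 0 < w x.
Proof.
move=> xJ; rewrite mulr_gt0 ?powR_gt0 ?one_sub_sqr_gt0 //.
by apply: one_sub_k2_sqr_gt0; move: x xJ; exact: subset_itv_oo_cc.
Qed.

Lemma weight_ge0 (x : R) : 0 <= w x.
Proof. by rewrite mulr_ge0 ?powR_ge0. Qed.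

(** If the integral vanished, the integrand would vanish almost everywhere,
    whereas it is positive on a ball around any point of ]-1, 1[ that is not a
    root of p. *)
Lemma wint_sqr_neq0 (p : {poly R}) : p != 0 -> wint (p * p) != 0.
Proof.
move=> /exists_nonroot_itv[x0 x0J px0]; apply/eqP => int0.
pose g x := (p * p).[x] * w x.
have g0 x : 0 <= g x.
  by rewrite mulr_ge0 ?weight_ge0 // hornerM -expr2 sqr_ge0.
have gint : mu.-integrable J (EFin \o g) by exact: integrable_poly_weight.
have mg : measurable_fun J (EFin \o g) by case/integrableP: gint.
have : ae_eq mu J (EFin \o g) (cst 0%E).
  apply/(ae_eq_integral_abs mu _ mg) => //.
  transitivity (\int[mu]_(x in J) (EFin \o g) x)%E.
    by apply: eq_integral => x _ /=; rewrite ger0_norm.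
  by rewrite -[LHS]fineK ?integrable_fin_num //; congr (_%:E).
have [e /= e0 eJ] :
    nbhs x0 ([set x | x \in `](-1)%R, 1%R[] `&` [set x | p.[x] != 0]).
  apply: filterI; first exact: near_in_itvoo.
  exact: (cvgr_neq0 (p.[x0]) (@continuous_horner R p x0)).
move=> g_ae0.
have : mu.-negligible (ball x0 e).
  apply: negligibleS g_ae0 => x xe /=.
  have [xJ px] := eJ x xe.
  have xJ' : x \in `[(-1), 1] by move: x xJ {xe px}; exact: subset_itv_oo_cc.
  move=> /(_ xJ') /= [] /eqP; apply/negP.
  by rewrite gt_eqF // /g mulr_gt0 ?weight_gt0 // hornerM -expr2 exprn_even_gt0.
have mB : measurable (ball x0 e : set (measurableTypeR R)).
  exact: measurable_ball.
move=> /(negligibleP _ mB) B0.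
have : (e *+ 2)%:E = 0%E by rewrite -(lebesgue_measure_ball x0 (ltW e0)).
by move=> /eqP; rewrite eqe mulrn_eq0 /= gt_eqF.
Qed.

End WeightFunctional.

Lemma measurable_weight (R : realType) (alpha beta k : R) (D : set R) :
  measurable_fun D (weight alpha beta k).
Proof.
have mpow (p : {poly R}) a : measurable_fun D (fun x => p.[x] `^ a).
  apply: measurable_funTS; apply: (measurableT_comp (measurable_powR a)).
  exact: measurable_poly.
rewrite (_ : weight _ _ _ = (fun x : R => (1 - 'X^2 : {poly R}).[x] `^ alpha)
    \* (fun x : R => (1 - k ^+ 2 *: 'X^2 : {poly R}).[x] `^ beta)).
  exact: measurable_funM.
by apply/funext => x /=; rewrite /weight !hornerE.
Qed.

Lemma wint_pearson (R : realType) (alpha beta k : R) :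
  -1 < alpha -> 0 < k ^+ 2 < 1 ->
  (@lebesgue_measure R).-integrable `[(-1)%R, 1%R]%classic
    (EFin \o weight alpha beta k) ->
  forall f : {poly R},
  wint alpha beta k
    (sigma (k ^+ 2) * f^`() + tau alpha beta (k ^+ 2) * f) = 0.
Proof.
move=> alpha_gt k2 w_int f; set u : {poly R} := 1 - 'X^2.
set v : {poly R} := 1 - k ^+ 2 *: 'X^2.
have tauE : tau alpha beta (k ^+ 2) =
    (alpha + 1) *: (u^`() * v) + (beta + 1) *: (u * v^`()).
  rewrite /tau /u /v !derivB derivC derivZ derivXn /= -!mul_polyC.
  rewrite !(polyCN, polyCM, polyCD) expr1.
  by ring.
have wE x : weight alpha beta k x = u.[x] `^ alpha * v.[x] `^ beta.
  by rewrite /weight /u /v !hornerE.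
have := integrable_poly_weight alpha beta k w_int
  (sigma (k ^+ 2) * f^`() + tau alpha beta (k ^+ 2) * f).
rewrite /wint tauE /sigma -/u -/v.
under eq_Rintegral do rewrite wE.
under [X in _.-integrable _ X]eq_fun do rewrite wE.
move=> gint; apply: pearson_powR => //.
- by rewrite -ltrBlDr sub0r.
- by rewrite /u !hornerE; ring.
- by rewrite /u !hornerE; ring.
- by move=> x /one_sub_sqr_gt0; rewrite /u !hornerE.
- by move=> x /(one_sub_k2_sqr_gt0 _ k2); rewrite /v !hornerE.
Qed.

End Analysis.

(** * Elimination *)

Lemma resultant_common_root (F : comPzRingType) (a0 a1 a2 b0 b1 b2 x : F) :
  a0 * x ^+ 2 + a1 * x + a2 = 0 -> b0 * x ^+ 2 + b1 * x + b2 = 0 ->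
  (a0 * b2 - a2 * b0) ^+ 2 - (a0 * b1 - a1 * b0) * (a1 * b2 - a2 * b1) = 0.
Proof.
move=> /eqP; rewrite addrC addr_eq0 => /eqP -> /eqP.
by rewrite addrC addr_eq0 => /eqP ->; ring.
Qed.

(** Here x, y, z stand for b_(n+1), b_n, b_(n-1), the unknown is
    X = (1 - K) (r_n + alpha), and U, V are 1 - K times the differences
    r_(n+1) - r_n and r_n - r_(n-1).  The a_i are the coefficients of the
    quadratic equation coming from x^2 = 1, the p_i those of the equation coming
    from x^2 = 1/K in the unknown N (1 - K) - X, and the b_i rewrite the latter
    in terms of X. *)
Lemma difference_polynomial_resultant (R : realType)
    (alpha beta k n x y z : R) :
  let N := alpha + beta + n in
  let K := k ^+ 2 in let D := 1 - K in
  let U := 1 - K * ((2 * N + 3) * x - (2 * N - 1) * y) in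
  let V := 1 - K * ((2 * N + 1) * y - (2 * N - 3) * z) in
  let a0 := 1 - 4 * y in
  let a1 := - 2 * y * (U - V) in
  let a2 := y * U * V - alpha ^+ 2 * D ^+ 2 in
  let p0 := 1 - 4 * K * y in
  let p1 := 2 * K * y * (U - V) in
  let p2 := K * y * (D - U) * (D - V) - beta ^+ 2 * D ^+ 2 in
  let b0 := p0 in
  let b1 := - (2 * N * D * p0 + p1) in
  let b2 := p0 * (N * D) ^+ 2 + p1 * (N * D) + p2 in
  D ^+ 2 * (\sum_(p < 4) \sum_(q < 7) \sum_(r < 4 | (p + q + r <= 6)%N)
     coef alpha beta k n p q r * x ^+ p * y ^+ q * z ^+ r)
  = (a0 * b2 - a2 * b0) ^+ 2 - (a0 * b1 - a1 * b0) * (a1 * b2 - a2 * b1).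
Proof.
rewrite /=.
under eq_bigr do under eq_bigr do rewrite big_mkcond /=.
rewrite !big_ord_recr !big_ord0 /=.
rewrite /c000 /c010 /c011 /c020 /c021 /c022 /c030 /c031 /c032 /c033 /c040
  /c041 /c042 /c050 /c051 /c060 /c110 /c111 /c120 /c121 /c122 /c130 /c131
  /c132 /c140 /c141 /c150 /c220 /c221 /c222 /c230 /c231 /c240 /c330.
by field.
Qed.

(** Here rho, u, v stand for r_n + alpha, r_(n+1) - r_n and r_n - r_(n-1);
    multiplying both quadratic equations by (1 - K)^2 clears the denominators
    of u and v. *)
Lemma difference_equation (R : realType) (alpha beta k n x y z rho u v : R) :
  let N := alpha + beta + n in
  let K := k ^+ 2 in
  1 - K != 0 ->
  (1 - K) * u = 1 - K * ((2 * N + 3) * x - (2 * N - 1) * y) ->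
  (1 - K) * v = 1 - K * ((2 * N + 1) * y - (2 * N - 3) * z) ->
  rho ^+ 2 - alpha ^+ 2 = y * (2 * rho + u) * (2 * rho - v) ->
  (N - rho) ^+ 2 - beta ^+ 2 =
    K * (y * (2 * (N - rho) + 1 - u) * (2 * (N - rho) - 1 + v)) ->
  \sum_(p < 4) \sum_(q < 7) \sum_(r < 4 | (p + q + r <= 6)%N)
     coef alpha beta k n p q r * x ^+ p * y ^+ q * z ^+ r = 0.
Proof.
move=> N K K1 eU eV e1 e2.
apply: (mulfI (expf_neq0 2 K1)); rewrite mulr0.
have /= -> := difference_polynomial_resultant R alpha beta k n x y z.
rewrite -/N -/K -eU -eV.
apply: (resultant_common_root _ _ _ _ _ _ _ ((1 - K) * rho)).
- transitivity ((1 - K) ^+ 2 * (rho ^+ 2 - alpha ^+ 2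
    - y * (2 * rho + u) * (2 * rho - v))); first by ring.
  by rewrite e1; ring.
- transitivity ((1 - K) ^+ 2 * ((N - rho) ^+ 2 - beta ^+ 2
    - K * (y * (2 * (N - rho) + 1 - u) * (2 * (N - rho) - 1 + v)))).
    by ring.
  by rewrite e2; ring.
Qed.

(** c060 vanishes only for N = 3/2 or N = -3/2, where c330 and c033 respectively
    take over. *)
Lemma coef_degree6_neq0 (R : realType) (alpha beta k n : R) : k != 0 ->
  exists p q r : nat,
    (p + q + r)%N = 6%N /\ coef alpha beta k n p q r != 0.
Proof.
move=> k0; pose N := alpha + beta + n.
have [N3|N3] := eqVneq (2 * N - 3) 0.
  exists 3, 3, 0; split => //=; rewrite /c330 -/N.
  have -> : 2 * N = 3 by apply/eqP; rewrite -subr_eq0 N3.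
  by rewrite !mulf_neq0 ?expf_neq0 //; apply/eqP; lra.
have [N3'|N3'] := eqVneq (2 * N + 3) 0.
  exists 0, 3, 3; split => //=; rewrite /c033 -/N.
  have -> : 2 * N = - 3 by apply/eqP; rewrite -addr_eq0 N3'.
  by rewrite !mulf_neq0 ?expf_neq0 //; apply/eqP; lra.
exists 0, 6, 0; split => //=.
by rewrite /c060 -/N !mulf_neq0 ?expf_neq0.
Qed.

Theorem theorem1p4 (R : realType) (alpha beta k : R)
    (halpha : -1 < alpha) (hk : 0 < k ^+ 2 < 1)
    (P : nat -> {poly R}) (h b : nat -> R)
    (hP : monic_orthogonal alpha beta k P h)
    (hb : recurrence_coef P b)
    (n : nat) (hn : (1 <= n)%N) :
  \sum_(p < 4) \sum_(q < 7) \sum_(r < 4 | (p + q + r <= 6)%N)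
     coef alpha beta k n%:R p q r
       * b n.+1 ^+ p * b n ^+ q * b n.-1 ^+ r = 0
  /\ (exists p q r : nat,
        (p + q + r)%N = 6%N /\ coef alpha beta k n%:R p q r != 0).
Proof.
have [k0 k1] : 0 < k ^+ 2 /\ k ^+ 2 < 1 by case/andP: hk.
split; last first.
  by apply: coef_degree6_neq0; apply: contraTneq k0 => ->; rewrite expr0n ltxx.
case: hP hb => monic_sizeP orthP [b0 recP].
have monP i : P i \is monic by case: (monic_sizeP i).
have sizeP i : size (P i) = i.+1 by case: (monic_sizeP i).
pose mu := @lebesgue_measure R.
have w_int :
    mu.-integrable `[(-1)%R, 1%R]%classic (EFin \o weight alpha beta k).
  have P0 : P 0%N = 1.
    rewrite [P 0%N]size1_polyC ?sizeP //.
    by have /monicP := monP 0%N; rewrite /lead_coef sizeP /= => ->.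
  apply/integrableP; split.
    by apply/measurable_EFinP; exact: measurable_weight.
  have := orthP 0%N 0%N; rewrite P0 /= => e.
  rewrite (_ : (\int[mu]_(x in _) _)%E = (h 0%N)%:E) ?ltry // -e.
  apply: eq_integral => x _ /=.
  by rewrite ger0_norm; [rewrite hornerC !mul1r|exact: weight_ge0].
pose L := wint alpha beta k.
pose Lmix := GRing.isLinear.Build R {poly R} R *%R L
  (wint_scalar alpha beta k w_int).
pose L' : {scalar {poly R}} := HB.pack L Lmix.
have orthL i j : L' (P i * P j) = if i == j then h j else 0.
  rewrite -[LHS]/(L _) /L /wint /Rintegral.
  under eq_integral do rewrite hornerM.
  by rewrite orthP.
have h_neq0 i : h i != 0.
  have := orthL i i; rewrite eqxx => <-.
  by apply: wint_sqr_neq0 => //; exact: monic_neq0.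
have pearson := wint_pearson R alpha beta k halpha hk w_int.
have string := string_equation L' P h b sizeP monP orthL b0 recP
  alpha beta (k ^+ 2) pearson h_neq0.
have K_neq1 : 1 - k ^+ 2 != 0 by rewrite subr_eq0 gt_eqF.
pose s := bsum b.
have s0 : s 0%N = 0 by exact: bsum0.
have sS i : s i.+1 = s i + b i by exact: bsumS.
pose r := ladder_r alpha beta (k ^+ 2) b s.
have q1 := ladder_quadratic_at_1 alpha beta (k ^+ 2) b s K_neq1 b0 s0 sS
  string n.
have q2 := ladder_quadratic_at_inv_k alpha beta (k ^+ 2) b s K_neq1 b0 s0 sS
  string n.
have rS := ladder_r_diff alpha beta (k ^+ 2) b s K_neq1 sS.
case: n hn q1 q2 => // m _; rewrite /ladder_S /ladder_R /= -/r => q1 q2.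
apply: (difference_equation _ _ _ _ _ _ _ _ (r m.+1 + alpha)
  (r m.+2 - r m.+1) (r m.+1 - r m)) => //.
- by rewrite /r rS -(natr1 m); ring.
- transitivity (r m.+1 * (r m.+1 + 2 * alpha)); first by ring.
  by rewrite q1; ring.
- transitivity ((m.+1%:R - r m.+1) * (m.+1%:R - r m.+1 + 2 * beta)).
    by ring.
  by rewrite q2 -(natr1 m); ring.
Qed.
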